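(* The coefficient array of the dual Fibonacci polynomials $\hat{F}_1(y), \hat{F}_2(y), \hat{F}_3(y), \ldots$ is the exponential Riordan array $$\left[\frac{I_1(2ix)}{ix},\, -x\right], \qquad i=\sqrt{-1}.$$
   Context: The Fibonacci polynomials $F_n(y)$, $n\ge 0$, are defined by the generating function $\sum_{n\ge 0}F_n(y)x^n = F(x,y)=\frac{x}{1-yx-x^2}$. The dual Fibonacci polynomials $\hat F_n(y)$, $n\ge 0$, are the polynomials defined by $\sum_{n\ge0}\hat F_n(y)x^n=u(x)$, where $u(x)$ is the compositional inverse (series reversion) of $F(x,y)$ with respect to $x$, i.e. the unique formal power series in $x$ with coefficients in $\mathbb{Q}[y]$ such that $u(0)=0$ and $\frac{u}{1-yu-u^2}=x$. The coefficient array of a sequence of polynomials $P_1(y),P_2(y),\ldots$ is the infinite lower-triangular matrix $(p_{n,k})_{n,k\ge 0}$ with $P_{n+1}(y)=\sum_{k=0}^n p_{n,k}y^k$. For formal power series $g(x)$, $f(x)$ with $g(0)\ne0$, $f(0)=0$, $f'(0)\neq 0$, the exponential Riordan array $[g(x),f(x)]$ is the matrix whose $(n,k)$ entry ($n,k\ge 0$) is $\frac{n!}{k!}[x^n]\,g(x)f(x)^k$. $I_1$ is the modified Bessel function of the first kind, $I_1(z)=\sum_{m\ge0}\frac{(z/2)^{2m+1}}{m!(m+1)!}$, and $\frac{I_1(2ix)}{ix}$ is understood as a formal power series in $x$. *)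

(* Defs.v *)
From HB Require Import structures.
From mathcomp Require Import all_boot all_order all_algebra.
From mathcomp Require Import boolp classical_sets.

Set Implicit Arguments.
Unset Strict Implicit.
Unset Printing Implicit Defensive.

Import Order.TTheory GRing.Theory Num.Theory.
Local Open Scope ring_scope.

(* A formal power series f is its coefficient sequence: f n is [x^n] f. *)
Record fps (R : Type) := Fps { fps_coef :> nat -> R }.

HB.instance Definition _ (R : Type) := gen_eqMixin (fps R).
HB.instance Definition _ (R : Type) := gen_choiceMixin (fps R).

Lemma fpsP (R : Type) (f g : fps R) : (forall n, f n = g n) -> f = g.
Proof. by case: f g => [f] [g] /= /funext ->. Qed.

(* Locked so that simplification and unification do not expand the sums. *)
HB.lock Definition fps_mul (R : comNzRingType) (f g : fps R) : fps R :=
  Fps (fun n => \sum_(i < n.+1) f i * g (n - i)%N).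

Lemma fps_mulE (R : comNzRingType) (f g : fps R) n :
  fps_mul f g n = \sum_(i < n.+1) f i * g (n - i)%N.
Proof. by rewrite fps_mul.unlock. Qed.

Section FpsRing.
Variable R : comNzRingType.
Implicit Types f g h : fps R.

Definition fps_zero : fps R := Fps (fun _ => 0).
Definition fps_opp f : fps R := Fps (fun n => - f n).
Definition fps_add f g : fps R := Fps (fun n => f n + g n).

Lemma fps_addA : associative fps_add.
Proof. by move=> f g h; apply: fpsP => n /=; rewrite addrA. Qed.
Lemma fps_addC : commutative fps_add.
Proof. by move=> f g; apply: fpsP => n /=; rewrite addrC. Qed.
Lemma fps_add0 : left_id fps_zero fps_add.
Proof. by move=> f; apply: fpsP => n /=; rewrite add0r. Qed.
Lemma fps_addN : left_inverse fps_zero fps_opp fps_add.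
Proof. by move=> f; apply: fpsP => n /=; rewrite addNr. Qed.

HB.instance Definition _ :=
  GRing.isZmodule.Build (fps R) fps_addA fps_addC fps_add0 fps_addN.

Definition fps_const (c : R) : fps R := Fps (fun n => if n == 0%N then c else 0).

(* Truncation to a polynomial, used to transfer the ring laws. *)
Definition fps_trunc N f : {poly R} := \poly_(i < N) f i.

Lemma coef_fps_trunc N f i : (i < N)%N -> (fps_trunc N f)`_i = f i.
Proof. by move=> iN; rewrite coef_poly iN. Qed.

Lemma fps_mul_trunc N f g n : (n < N)%N ->
  fps_mul f g n = (fps_trunc N f * fps_trunc N g)`_n.
Proof.
move=> nN; rewrite fps_mulE coefM; apply: eq_bigr => i _.
have iN : (i < N)%N by apply: leq_ltn_trans nN; rewrite -ltnS.
by rewrite !coef_fps_trunc // (leq_ltn_trans (leq_subr _ _) nN).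
Qed.

Lemma fps_mulC : commutative (@fps_mul R).
Proof.
by move=> f g; apply: fpsP => n; rewrite !(@fps_mul_trunc n.+1) // mulrC.
Qed.

Lemma fps_mulA : associative (@fps_mul R).
Proof.
move=> f g h; apply: fpsP => n.
pose t k := fps_trunc n.+1 k.
have -> : fps_mul f (fps_mul g h) n = (t f * (t g * t h))`_n.
  rewrite fps_mulE coefM; apply: eq_bigr => i _ /=.
  rewrite coef_fps_trunc // -(@fps_mul_trunc n.+1) //.
  by rewrite ltnS leq_subr.
rewrite mulrA fps_mulE coefM; apply: eq_bigr => i _ /=.
by rewrite coef_fps_trunc ?ltnS ?leq_subr // -(@fps_mul_trunc n.+1).
Qed.

Lemma fps_mul1 : left_id (fps_const 1) (@fps_mul R).
Proof.
move=> f; apply: fpsP => n; rewrite fps_mulE big_ord_recl /= mul1r subn0.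
by rewrite big1 ?addr0 // => i _; rewrite mul0r.
Qed.

Lemma fps_mulDl : left_distributive (@fps_mul R) fps_add.
Proof.
move=> f g h; apply: fpsP => n; rewrite /= !fps_mulE -big_split /=.
by apply: eq_bigr => i _; rewrite mulrDl.
Qed.

Lemma fps_one_neq0 : fps_const 1 != 0.
Proof.
apply/eqP => /(congr1 (fun f : fps R => f 0%N)) /= /eqP.
by rewrite oner_eq0.
Qed.

HB.instance Definition _ := GRing.Zmodule_isComNzRing.Build (fps R)
  fps_mulA fps_mulC fps_mul1 fps_mulDl fps_one_neq0.

Lemma fps0E n : (0 : fps R) n = 0. Proof. by []. Qed.
Lemma fps1E n : (1 : fps R) n = if n == 0%N then 1 else 0. Proof. by []. Qed.
Lemma fpsNE f n : (- f) n = - f n. Proof. by []. Qed.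
Lemma fpsDE f g n : (f + g) n = f n + g n. Proof. by []. Qed.
Lemma fpsBE f g n : (f - g) n = f n - g n. Proof. by []. Qed.
Lemma fpsME f g n : (f * g) n = \sum_(i < n.+1) f i * g (n - i)%N.
Proof. exact: fps_mulE. Qed.
Lemma fps_sumE (I : Type) (r : seq I) (P : pred I) (F : I -> fps R) n :
  (\sum_(i <- r | P i) F i) n = \sum_(i <- r | P i) F i n.
Proof. by elim/big_rec2: _ => // i x y _ <-. Qed.

Lemma fpsM0E f g : (f * g) 0%N = f 0%N * g 0%N.
Proof. by rewrite fpsME big_ord_recl big_ord0 addr0. Qed.

Lemma fps_constM c f n : (fps_const c * f) n = c * f n.
Proof.
rewrite fpsME big_ord_recl /= subn0 big1 ?addr0 // => i _.
by rewrite mul0r.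
Qed.

Lemma fps_const_is_additive : zmod_morphism fps_const.
Proof. by move=> a b; apply: fpsP => -[|n] //=; rewrite subr0. Qed.
Lemma fps_const_is_multiplicative : monoid_morphism fps_const.
Proof.
split=> // a b; apply: fpsP => n.
by rewrite fps_constM /=; case: eqP; rewrite ?mulr0.
Qed.
HB.instance Definition _ :=
  GRing.isZmodMorphism.Build R (fps R) fps_const fps_const_is_additive.
HB.instance Definition _ :=
  GRing.isMonoidMorphism.Build R (fps R) fps_const fps_const_is_multiplicative.

Lemma fps_const1 : fps_const 1 = 1. Proof. by []. Qed.
Lemma fps_constMM a b : fps_const (a * b) = fps_const a * fps_const b.
Proof. exact: rmorphM. Qed.

(* f \in O(x^m) *)
Definition fps_order m f := forall i, (i < m)%N -> f i = 0.

Lemma fps_orderM m n f g :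
  fps_order m f -> fps_order n g -> fps_order (m + n) (f * g).
Proof.
move=> fm gn i imn; rewrite fpsME big1 // => j _.
have [jm|mj] := ltnP j m; first by rewrite fm ?mul0r.
rewrite gn ?mulr0 // ltn_subLR; last by rewrite -ltnS.
by rewrite (leq_trans imn) // leq_add2r.
Qed.

Lemma fps_order_le m n f : (m <= n)%N -> fps_order n f -> fps_order m f.
Proof. by move=> mn fn i im; apply: fn; apply: leq_trans mn. Qed.

Lemma fps_orderX f k : f 0%N = 0 -> fps_order k (f ^+ k).
Proof.
move=> f0; elim: k => [|k IHk]; first by [].
by rewrite exprS -add1n; apply: fps_orderM => // -[].
Qed.

Definition fps_X : fps R := Fps (fun n => if n == 1%N then 1 else 0).

Lemma fps_XM f n : (fps_X * f) n = if n is m.+1 then f m else 0.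
Proof.
case: n => [|n]; first by rewrite fpsM0E mul0r.
rewrite fpsME !big_ord_recl /= mul0r add0r mul1r subSS subn0 big1 ?addr0 //.
by move=> i _; rewrite mul0r.
Qed.

End FpsRing.

(* Composition f(g(x)), meaningful when g(0) = 0: the terms of index k > n
   do not contribute to the coefficient of x^n. *)
HB.lock Definition fps_comp (R : comNzRingType) (f g : fps R) : fps R :=
  Fps (fun n => \sum_(k < n.+1) f k * (g ^+ k) n).

Lemma fps_compE (R : comNzRingType) (f g : fps R) n :
  fps_comp f g n = \sum_(k < n.+1) f k * (g ^+ k) n.
Proof. by rewrite fps_comp.unlock. Qed.

Section FpsComp.
Variable R : comNzRingType.
Implicit Types f g h : fps R.

Lemma fps_comp_widen f g n N : g 0%N = 0 -> (n < N)%N ->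
  fps_comp f g n = \sum_(k < N) f k * (g ^+ k) n.
Proof.
move=> g0 nN; rewrite fps_compE.
rewrite (big_ord_widen N (fun k => f k * (g ^+ k) n)) //.
rewrite big_mkcond; apply: eq_bigr => k _; case: ltnP => // nk.
by rewrite (fps_orderX g0) ?mulr0.
Qed.

Lemma fps_compD f h g : fps_comp (f + h) g = fps_comp f g + fps_comp h g.
Proof.
apply: fpsP => n; rewrite fpsDE !fps_compE -big_split.
by apply: eq_bigr => k _; rewrite fpsDE mulrDl.
Qed.

Lemma fps_compN f g : fps_comp (- f) g = - fps_comp f g.
Proof.
apply: fpsP => n; rewrite fpsNE !fps_compE -sumrN.
by apply: eq_bigr => k _; rewrite fpsNE mulNr.
Qed.

Lemma fps_compC c g : fps_comp (fps_const c) g = fps_const c.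
Proof.
apply: fpsP => n; rewrite fps_compE big_ord_recl expr0 big1 => [|i _].
  by rewrite addr0 fps1E /=; case: eqP; rewrite ?mulr1 ?mulr0.
by rewrite mul0r.
Qed.

Lemma fps_compX g : g 0%N = 0 -> fps_comp (fps_X R) g = g.
Proof.
move=> g0; apply: fpsP => -[|n].
  by rewrite fps_compE big_ord_recl big_ord0 mul0r addr0 g0.
rewrite fps_compE !big_ord_recl /= mul0r add0r mul1r expr1 big1 ?addr0 // => i _.
by rewrite mul0r.
Qed.

Lemma fps_comp_horner (p : {poly R}) g n N : (size p <= N)%N ->
  (map_poly (@fps_const R) p).[g] n = \sum_(k < N) p`_k * (g ^+ k) n.
Proof.
move=> pN; rewrite (@horner_coef_wide _ N); last first.
  by rewrite (leq_trans (size_poly _ _)).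
rewrite fps_sumE; apply: eq_bigr => k _.
by rewrite coef_map fps_constM.
Qed.

Lemma fps_mul_eq (f f' g g' : fps R) n :
  (forall i, (i <= n)%N -> f i = f' i) ->
  (forall i, (i <= n)%N -> g i = g' i) -> (f * g) n = (f' * g') n.
Proof.
move=> ff' gg'; rewrite !fpsME; apply: eq_bigr => i _.
by rewrite ff' ?gg' ?leq_subr // -ltnS ltn_ord.
Qed.

Lemma fps_compM f h g : g 0%N = 0 ->
  fps_comp (f * h) g = fps_comp f g * fps_comp h g.
Proof.
move=> g0; apply: fpsP => n.
pose t (k : fps R) : {poly R} := fps_trunc n.+1 k.
have tE k i : (i <= n)%N -> fps_comp k g i = (map_poly (@fps_const R) (t k)).[g] i.
  move=> le_in; rewrite (@fps_comp_horner _ _ _ n.+1) ?size_poly //.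
  rewrite (@fps_comp_widen _ _ _ n.+1) //; apply: eq_bigr => j _.
  by rewrite coef_fps_trunc.
rewrite (fps_mul_eq (tE f) (tE h)) -hornerM -rmorphM /=.
pose N := (n.+1 + size (t f * t h)%R)%N.
rewrite (@fps_comp_horner _ _ _ N) ?leq_addl //.
rewrite (@fps_comp_widen _ _ _ N) ?leq_addr //.
apply: eq_bigr => k _; have [kn|nk] := ltnP k n.+1.
  by rewrite -(@fps_mul_trunc _ n.+1).
by rewrite (fps_orderX g0) ?mulr0.
Qed.

End FpsComp.

Section FpsUnitRing.
Variable R : comUnitRingType.
Implicit Types f g h u v : fps R.

Definition fps_unit : {pred fps R} := [pred f : fps R | f 0%N \is a GRing.unit].

(* 1/f = c^-1 \sum_k (1 - c^-1 f)^k with c = f(0); the terms of index k > n do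
   not contribute to the coefficient of x^n. *)
Definition fps_inv f : fps R :=
  if f 0%N \is a GRing.unit then
    let c := (f 0%N)^-1 in
    Fps (fun n => c * \sum_(k < n.+1) ((1 - fps_const c * f) ^+ k) n)
  else f.

Lemma fps_mulVx : {in fps_unit, left_inverse 1 fps_inv *%R}.
Proof.
move=> f uf; have uf0 : f 0%N \is a GRing.unit by [].
rewrite /fps_inv uf0; set c := (f 0%N)^-1.
set e : fps R := 1 - fps_const c * f.
have e0 : e 0%N = 0 by rewrite fpsBE fps_constM /= mulVr // subrr.
have fE : f = fps_const (f 0%N) * (1 - e).
  rewrite /e opprB addrCA subrr addr0 mulrA -fps_constMM mulrV //.
  by rewrite fps_const1 mul1r.
apply: fpsP => n.
pose s := \sum_(k < n.+1) e ^+ k.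
rewrite (@fps_mul_eq _ _ (fps_const c * s) _ f) // => [|i le_in]; last first.
  rewrite fps_constM /s fps_sumE /= (big_ord_widen n.+1 (fun k => (e ^+ k) i)) //.
  congr (_ * _); rewrite big_mkcond; apply: eq_bigr => k _; case: ltnP => // ik.
  by rewrite (fps_orderX e0).
rewrite fE mulrACA -fps_constMM mulVr //.
rewrite fps_const1 mul1r mulrC /s.
rewrite -[1 - e]opprB mulNr -subrX1 opprB fpsBE (fps_orderX e0) //.
by rewrite subr0.
Qed.

Lemma fps_unitPl f g : g * f = 1 -> fps_unit f.
Proof.
move=> /(congr1 (fun h : fps R => h 0%N)); rewrite fpsM0E /= => gf1.
by apply/unitrPr; exists (g 0%N); rewrite mulrC.
Qed.

Lemma fps_inv_out : {in [predC fps_unit], fps_inv =1 id}.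
Proof. by move=> f /negPf; rewrite /fps_inv unfold_in /= => ->. Qed.

HB.instance Definition _ := GRing.ComNzRing_hasMulInverse.Build (fps R)
  fps_mulVx fps_unitPl fps_inv_out.

Lemma fps_unitE f : (f \is a GRing.unit) = (f 0%N \is a GRing.unit).
Proof. by []. Qed.

Definition fps_is_reversion f u := u 0%N = 0 /\ fps_comp f u = fps_X R.

(* The compositional inverse of f; it exists and is unique when f(0) = 0 and
   f'(0) is invertible (fps_revP and fps_rev_unique), and is 0 by convention
   when f has no compositional inverse. *)
Definition fps_rev f : fps R :=
  xget 0 [set u | fps_is_reversion f u]%classic.

(* The compositional inverses of f are the fixed points of step f, which is
   contracting for the x-adic topology. *)
Let h f : fps R := f - fps_const (f 1%N) * fps_X R.
Let step f u : fps R := fps_const (f 1%N)^-1 * (fps_X R - fps_comp (h f) u).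

Lemma fps_rev_stepP f u : f 1%N \is a GRing.unit -> u 0%N = 0 ->
  fps_comp f u = fps_X R <-> step f u = u.
Proof.
move=> uf1 u0.
have cfE : fps_comp f u = fps_const (f 1%N) * u + fps_comp (h f) u.
  rewrite -{2}[u](fps_compX u0) -{1}(fps_compC (f 1%N) u) -fps_compM //.
  by rewrite -fps_compD /h addrCA subrr addr0.
have cK a : fps_const (f 1%N)^-1 * (fps_const (f 1%N) * a) = a.
  by rewrite mulrA -fps_constMM mulVr // fps_const1 mul1r.
have cK' a : fps_const (f 1%N) * (fps_const (f 1%N)^-1 * a) = a.
  by rewrite mulrA -fps_constMM mulrV // fps_const1 mul1r.
rewrite /step; split=> [fu|su].
  have -> : fps_X R - fps_comp (h f) u = fps_const (f 1%N) * u.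
    by rewrite -fu cfE addrK.
  exact: cK.
have -> : fps_comp f u = fps_const (f 1%N) * (step f u) + fps_comp (h f) u.
  by rewrite cfE /step su.
by rewrite cK' subrK.
Qed.

Lemma fps_comp0E f u : fps_comp f u 0%N = f 0%N.
Proof. by rewrite fps_compE big_ord_recl big_ord0 mulr1 addr0. Qed.

Lemma fps_stepE f u i :
  step f u i = (f 1%N)^-1 * (fps_X R i - fps_comp (h f) u i).
Proof. exact: fps_constM. Qed.

Lemma fps_step0 f u : f 0%N = 0 -> step f u 0%N = 0.
Proof.
move=> f0; rewrite fps_constM fpsBE fps_comp0E fpsBE fps_constM f0.
by rewrite mulr0 !subr0 mulr0.
Qed.

Lemma fps_order_subX u v m k : u 0%N = 0 -> v 0%N = 0 ->
  fps_order m (u - v) -> fps_order m.+1 (u ^+ k.+2 - v ^+ k.+2).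
Proof.
move=> u0 v0 uv; rewrite subrXX -addn1; apply: fps_orderM => // -[|//] _.
rewrite fps_sumE big1 // => i _; rewrite fpsM0E.
have powE (w : fps R) j : w 0%N = 0 -> (0 < j)%N -> (w ^+ j) 0%N = 0.
  by move=> w0 j_gt0; apply: fps_orderX.
have [i0|i_gt0] := posnP i; first by rewrite powE ?mul0r // i0 subn0.
by rewrite [X in _ * X]powE ?mulr0.
Qed.

Lemma fps_step_contract f u v m : f 0%N = 0 -> u 0%N = 0 -> v 0%N = 0 ->
  fps_order m (u - v) -> fps_order m.+1 (step f u - step f v).
Proof.
move=> f0 u0 v0 uv i im; rewrite fpsBE !fps_stepE.
suff -> : fps_comp (h f) u i = fps_comp (h f) v i by rewrite subrr.
rewrite !fps_compE; apply: eq_bigr => -[k /= _] _; case: k => [|[|k]].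
- by [].
- by rewrite fps_constM /= mulr1 subrr !mul0r.
congr (_ * _); apply/eqP; rewrite -subr_eq0 -fpsBE.
by rewrite (@fps_order_subX _ _ m).
Qed.

Lemma fps_rev_unique f u v : f 0%N = 0 -> f 1%N \is a GRing.unit ->
  fps_is_reversion f u -> fps_is_reversion f v -> u = v.
Proof.
move=> f0 uf1 [u0 /(fps_rev_stepP uf1 u0) su] [v0 /(fps_rev_stepP uf1 v0) sv].
have uv m : fps_order m (u - v).
  elim: m => [//|m IHm]; rewrite -su -sv; exact: fps_step_contract.
apply: fpsP => n; apply/eqP.
by rewrite -subr_eq0 -fpsBE (uv n.+1).
Qed.

Lemma fps_rev_exists f : f 0%N = 0 -> f 1%N \is a GRing.unit ->
  exists u, fps_is_reversion f u.
Proof.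
move=> f0 uf1; pose U m := iter m (step f) 0.
have U0 m : U m 0%N = 0 by case: m => [//|m]; apply: fps_step0.
have US m : fps_order m (U m.+1 - U m).
  elim: m => [//|m IHm].
  exact: (fps_step_contract f0 (U0 m.+1) (U0 m) IHm).
have Ust i m d : (i < m)%N -> U (m + d)%N i = U m i.
  move=> im; elim: d => [|d <-]; first by rewrite addn0.
  apply/eqP; rewrite -subr_eq0 -fpsBE addnS; apply/eqP/US.
  exact: ltn_addr.
pose u : fps R := Fps (fun n => U n.+1 n).
have u0 : u 0%N = 0 by apply: U0.
have uU m : fps_order m (u - U m).
  move=> i im; rewrite fpsBE -[u i]/(U i.+1 i) -(subnKC im) Ust //.
  by rewrite subrr.
exists u; split=> //; apply/(fps_rev_stepP uf1 u0).
apply: fpsP => n; apply/eqP; rewrite -subr_eq0 -fpsBE.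
have -> : step f u - u = (step f u - step f (U n)) - (u - U n.+1).
  by rewrite opprB addrA [U n.+1]/= subrK.
by rewrite fpsBE (fps_step_contract f0 u0 (U0 n) (uU n)) // (uU n.+1) ?subr0.
Qed.

Lemma fps_revP f : f 0%N = 0 -> f 1%N \is a GRing.unit ->
  fps_is_reversion f (fps_rev f).
Proof. by move=> f0 /(fps_rev_exists f0); apply: xgetPex. Qed.

End FpsUnitRing.

(* The series x / (1 - y x - x^2) over Q[y]; here y is 'X : {poly rat}, and
   the coefficient of x^n is the Fibonacci polynomial F_n(y). *)
Definition fib_den : fps {poly rat} :=
  1 - fps_const 'X * fps_X _ - fps_X _ ^+ 2.
Definition fib_gf : fps {poly rat} := fps_X _ / fib_den.

Definition dual_fib_gf : fps {poly rat} := fps_rev fib_gf.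
Definition dual_fib (n : nat) : {poly rat} := dual_fib_gf n.

Lemma fib_den0 : fib_den 0%N = 1.
Proof. by rewrite !fpsBE fps_constM fpsM0E mulr0 mul0r !subr0. Qed.

Lemma fib_den_unit : fib_den \is a GRing.unit.
Proof. by rewrite fps_unitE fib_den0 unitr1. Qed.

Lemma fib_gfE : fib_gf * fib_den = fps_X _.
Proof. by rewrite /fib_gf divrK // fib_den_unit. Qed.

Lemma fib_gf0 : fib_gf 0%N = 0.
Proof. by rewrite fpsM0E mul0r. Qed.

Lemma fib_gf1 : fib_gf 1%N = 1.
Proof.
have := congr1 (fun f : fps {poly rat} => f 1%N) fib_gfE.
rewrite fpsME !big_ord_recl big_ord0 fib_gf0 mul0r add0r addr0.
by rewrite [X in fib_den X](_ : _ = 0%N) // fib_den0 mulr1.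
Qed.

Lemma fib_gf_reversionP (u : fps {poly rat}) : u 0%N = 0 ->
  fps_is_reversion fib_gf u <->
  u / (1 - fps_const 'X * u - u ^+ 2) = fps_X _.
Proof.
move=> u0; set d := 1 - _ - _.
have ud : d \is a GRing.unit.
  by rewrite fps_unitE !fpsBE fps_constM fpsM0E u0 mulr0 mul0r !subr0 unitr1.
have dE : fps_comp fib_den u = d.
  rewrite /fib_den !fps_compD !fps_compN expr2 !fps_compM // fps_compC.
  by rewrite fps_compX // -fps_const1 fps_compC.
have fE : fps_comp fib_gf u * d = u.
  by rewrite -dE -fps_compM // fib_gfE fps_compX.
split=> [[_ fu]|fu]; first by rewrite -[in LHS]fE mulrK.
by split=> //; rewrite -fu -[in RHS]fE mulrK.
Qed.

Lemma dual_fib_gfP : dual_fib_gf 0%N = 0 /\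
  dual_fib_gf / (1 - fps_const 'X * dual_fib_gf - dual_fib_gf ^+ 2) = fps_X _.
Proof.
have uf1 : fib_gf 1%N \is a GRing.unit by rewrite fib_gf1 unitr1.
have r := fps_revP fib_gf0 uf1; have [r0 _] := r.
by split=> //; apply/(fib_gf_reversionP r0).
Qed.

Lemma dual_fib_gf_unique (u : fps {poly rat}) :
  u 0%N = 0 -> u / (1 - fps_const 'X * u - u ^+ 2) = fps_X _ ->
  u = dual_fib_gf.
Proof.
have uf1 : fib_gf 1%N \is a GRing.unit by rewrite fib_gf1 unitr1.
move=> u0 /(fib_gf_reversionP u0) ru.
exact: fps_rev_unique fib_gf0 uf1 ru (fps_revP fib_gf0 uf1).
Qed.

(* p is the coefficient array of P_1, P_2, ...; row n of p is P_{n+1}. *)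
Definition is_coef_array (R : nzRingType) (P : nat -> {poly R})
    (p : nat -> nat -> R) : Prop :=
  (forall n k, (n < k)%N -> p n k = 0) /\
  (forall n, P n.+1 = \sum_(k < n.+1) p n k *: 'X^k).

(* The array [g, f]; meant for g(0) != 0, f(0) = 0 and f'(0) != 0. *)
Definition exp_riordan (F : numFieldType) (g f : fps F) (n k : nat) : F :=
  n`!%:R / k`!%:R * (g * f ^+ k) n.

(* I_1(z): with n = 2m+1, n./2 = m. *)
Definition bessel_I1 (F : numFieldType) : fps F :=
  Fps (fun n => if odd n then 2^-1 ^+ n / ((n./2)`! * (n./2).+1`!)%:R else 0).

(* f(x) / (c x), meant for f(0) = 0 and c != 0 (fps_divXP). *)
Definition fps_divX (F : fieldType) (f : fps F) (c : F) : fps F :=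
  Fps (fun n => f n.+1 / c).

Lemma fps_divXP (F : fieldType) (f : fps F) (c : F) : f 0%N = 0 -> c != 0 ->
  fps_divX f c * (fps_const c * fps_X F) = f.
Proof.
move=> f0 c0; apply: fpsP => n; rewrite mulrCA fps_constM.
rewrite [fps_divX _ _ * _]mulrC fps_XM; case: n => [|n].
  by rewrite mulr0 f0.
by rewrite mulrC divfK.
Qed.

(* I_1(2ix) / (ix) *)
Definition bessel_quot (C : numClosedFieldType) : fps C :=
  fps_divX (fps_comp (bessel_I1 C) (fps_const (2 * 'i) * fps_X C)) 'i.

Lemma bessel_quotP (C : numClosedFieldType) :
  bessel_quot C * (fps_const 'i * fps_X C) =
  fps_comp (bessel_I1 C) (fps_const (2 * 'i) * fps_X C).
Proof. by rewrite fps_divXP ?neq0Ci // fps_comp0E. Qed.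

Lemma bessel_quot0 (C : numClosedFieldType) : bessel_quot C 0%N = 1.
Proof.
rewrite /bessel_quot [LHS]/= fps_compE !big_ord_recl big_ord0 addr0 mul0r add0r.
rewrite expr1 fps_constM /= expr1 mulr1 divr1 mulKf ?pnatr_eq0 //.
by rewrite divff ?neq0Ci.
Qed.

(* Main.v *)
Require Import Defs.
From mathcomp Require Import all_boot all_order all_algebra.
From mathcomp Require Import ring.

Set Implicit Arguments.
Unset Strict Implicit.
Unset Printing Implicit Defensive.

Import Order.TTheory GRing.Theory Num.Theory.
Local Open Scope ring_scope.

(** Why the theorem holds.  Write y for the polynomial variable and u for the
    generating function of the dual Fibonacci polynomials, so that
    u = x (1 - y u - u^2).  With s = x / (1 + y x) this reads u = s - s u^2,
    an equation free of y.  Hence u = v(s), where v = x A(x) and A is the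
    solution of A = 1 - x^2 A^2, i.e. A is the generating function of the
    Catalan numbers evaluated at - x^2.

    The coefficients of A are j! b_j, where b_j = [x^j] I_1(2ix)/(ix):
    the Bessel recurrence (j+2)(j+4) b_{j+2} = - 4 b_j becomes
    (j+4) a_{j+2} = - 4 (j+1) a_j for a_j = j! b_j, and this linear recurrence
    forces the quadratic one a_{n+2} = - \sum_(i+j=n) a_i a_j
    (aerated_catalan_conv).

    Finally [x^(n+1)] s^(j+1) = 'C(n, j) (- y)^(n-j) (coef_mobius_powS), so that
    [x^(n+1)] u = \sum_j j! b_j 'C(n, j) (- y)^(n-j).  Since
    j! 'C(n, j) = n! / (n-j)!, the coefficient of y^k is
    n!/k! (-1)^k b_(n-k), which is the (n, k) entry of the Riordan array. *)

(** Weighting a self-convolution by an affine function of one index only sees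
    the mean of that function, by the symmetry i <-> n - i. *)
Lemma self_conv_weight (R : comNzRingType) (a : nat -> R) (c : R) n :
  2 * \sum_(i < n.+1) (i%:R + c) * (a i * a (n - i)%N) =
  (n%:R + 2 * c) * \sum_(i < n.+1) a i * a (n - i)%N.
Proof.
rewrite mulr_natl mulr2n.
rewrite {2}(reindex_inj rev_ord_inj) /= -big_split mulr_sumr /=.
apply: eq_bigr => i _; have le_in : (i <= n)%N by rewrite -ltnS.
rewrite subSS subKn // natrB //; ring.
Qed.

(** The recurrence is the one of the aerated signed Catalan numbers
    1, 0, -1, 0, 2, 0, -5, ...; the conclusion says that their generating
    function solves A = 1 - x^2 A^2.  Computing the convolution of index n + 2
    with weight i + 2 in two ways, once by symmetry and once by shifting i with
    the recurrence, shows that the convolutions obey a two-step linear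
    recurrence satisfied by - a_(n+2) as well. *)
Lemma aerated_catalan_conv (F : numFieldType) (a : nat -> F) :
  a 0%N = 1 -> a 1%N = 0 ->
  (forall j, (j + 4)%:R * a j.+2 = - (4 * j.+1%:R * a j)) ->
  forall n, a n.+2 = - \sum_(i < n.+1) a i * a (n - i)%N.
Proof.
move=> a0 a1 aS; pose T n := \sum_(i < n.+1) a i * a (n - i)%N.
have TS n : (n + 6)%:R * T n.+2 = 4 * a n.+2 - 4 * n.+2%:R * T n.
  have := self_conv_weight a 2 n.+2; rewrite -/(T _) 2!big_ord_recl /=.
  rewrite /bump /= a0 a1 !subn0.
  (* The terms i = 0, 1 are split off; the others are shifted by aS. *)
  rewrite [X in _ + (_ + X)](_ : _ =
      - 4 * \sum_(i < n.+1) (i%:R + 1) * (a i * a (n - i)%N)); last first.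
    rewrite mulr_sumr; apply: eq_bigr => i _; rewrite !add1n !subSS mulrA.
    have -> : i.+2%:R + 2 = (i + 4)%:R :> F by rewrite -natrD !addSnnS.
    by rewrite aS -natr1; ring.
  move=> sumE.
  have symE := self_conv_weight a 1 n; rewrite -/(T _) in symE.
  have -> : (n + 6)%:R * T n.+2 = (n.+2%:R + 2 * 2) * T n.+2.
    by rewrite -natrM -natrD !addSnnS.
  have nSE : n.+2%:R = n%:R + 2 * 1 :> F by rewrite mulr1 -natrD addn2.
  rewrite -sumE nSE -mulrA -symE; ring.
have nz k : k.+1%:R != 0 :> F by rewrite pnatr_eq0.
move=> n; rewrite -/(T n).
(* Both parities at once, since the recurrences have step two. *)
suff [] : a n.+2 = - T n /\ a n.+3 = - T n.+1 by [].
elim: n => [|n [IHn IHn1]]; split=> //.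
- apply: (mulfI (nz 3)); rewrite /T big_ord_recl big_ord0 /= a0.
  by have := aS 0%N; rewrite a0 => ->; ring.
- have /eqP := aS 1%N; rewrite a1 mulr0 oppr0 mulf_eq0 pnatr_eq0 /= => /eqP ->.
  by rewrite /T !big_ord_recl big_ord0 /= /bump /= a0 a1; ring.
- have nz6 : (n + 6)%:R != 0 :> F by rewrite addnS.
  apply: (mulfI nz6); have := aS n.+2; rewrite addSnnS addSnnS => ->.
  rewrite mulrN TS -[T n]opprK -IHn -[n.+3%:R]natr1; ring.
Qed.

Lemma coef_fps_Xn (R : comNzRingType) k n :
  (fps_X R ^+ k) n = (n == k)%:R.
Proof.
elim: k n => [|k IHk] n; first by rewrite fps1E; case: n.
by rewrite exprS fps_XM; case: n.
Qed.

Lemma coef_fps_XnM (R : comNzRingType) (g : fps R) k n :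
  (fps_X R ^+ k * g) n = if (k <= n)%N then g (n - k)%N else 0.
Proof.
elim: k n => [|k IHk] n; first by rewrite mul1r subn0.
by rewrite exprS -mulrA fps_XM; case: n.
Qed.

(** The coefficients of I_1(2ix)/(ix), free of i so that they make sense over
    the rationals. *)
Definition bessel_coef (F : fieldType) (j : nat) : F :=
  if odd j then 0 else (-1) ^+ j./2 / (j./2`! * (j./2).+1`!)%:R.

Lemma bessel_quotE (C : numClosedFieldType) n :
  bessel_quot C n = bessel_coef C n.
Proof.
rewrite [LHS]/= fps_compE big_ord_recr /= big1 => [|k _]; last first.
  rewrite exprMn -rmorphXn fps_constM coef_fps_Xn.
  by rewrite gtn_eqF ?mulr0 // ltn_ord.
rewrite add0r exprMn -rmorphXn fps_constM coef_fps_Xn eqxx mulr1.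
rewrite /bessel_coef /=; case: (boolP (odd n)) => [_|/negbTE n_odd] /=.
  by rewrite !mul0r.
have := odd_double_half n; rewrite n_odd add0n uphalf_half n_odd add0n.
set m := n./2 => <-.
rewrite [_ / _%:R * _]mulrAC -exprMn mulKf ?pnatr_eq0 //.
by rewrite mulrAC exprSr mulfK ?neq0Ci // -mul2n exprM sqrCi.
Qed.

Lemma ratr_bessel_coef (C : numClosedFieldType) n :
  ratr (bessel_coef rat n) = bessel_coef C n.
Proof.
rewrite /bessel_coef; case: ifP => _; first exact: rmorph0.
by rewrite fmorph_div rmorphXn rmorphN1 rmorph_nat.
Qed.

(** Bessel's differential equation for I_1, read on coefficients. *)
Lemma bessel_coefSS (F : numFieldType) j :
  (j + 4)%:R * (j.+2%:R * bessel_coef F j.+2) = - (4 * bessel_coef F j).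
Proof.
rewrite /bessel_coef /= negbK; case: ifP => j_odd; first by rewrite !mulr0 oppr0.
have := odd_double_half j; rewrite j_odd add0n.
set m := j./2 => <-.
have nz k : k.+1%:R != 0 :> F by rewrite pnatr_eq0.
have nzf k : k`!%:R != 0 :> F by rewrite pnatr_eq0 -lt0n fact_gt0.
rewrite (factS m.+1) (factS m) exprS !natrM.
have -> : (m.*2 + 4)%:R = 2 * m.+2%:R :> F.
  by rewrite -natrM mul2n doubleS doubleS !addnS addn0.
have -> : m.*2.+2%:R = 2 * m.+1%:R :> F by rewrite -natrM mul2n doubleS.
by field; rewrite nzf nat1r -natrD !nz.
Qed.

Definition aerated_catalan (j : nat) : rat := j`!%:R * bessel_coef rat j.

Lemma aerated_catalanS n :
  aerated_catalan n.+2 =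
  - \sum_(i < n.+1) aerated_catalan i * aerated_catalan (n - i)%N.
Proof.
apply: aerated_catalan_conv n => [//|//|j].
rewrite /aerated_catalan !factS !natrM.
have := bessel_coefSS rat j; set x := bessel_coef _ _; set y := bessel_coef _ _.
move=> xE.
have -> : (j + 4)%:R * (j.+2%:R * (j.+1%:R * j`!%:R) * x) =
  j.+1%:R * j`!%:R * ((j + 4)%:R * (j.+2%:R * x)) by ring.
rewrite xE; ring.
Qed.

(** x A(x), with A the generating function of the aerated signed Catalan
    numbers: the reversion of x / (1 - x^2), i.e. the case y = 0. *)
Definition dual_fib_at0 : fps {poly rat} :=
  Fps (fun n => if n is j.+1 then (aerated_catalan j)%:P else 0).

Lemma dual_fib_at0E :
  dual_fib_at0 = fps_X _ - fps_X _ * (dual_fib_at0 * dual_fib_at0).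
Proof.
pose A : fps {poly rat} := Fps (fun n => (aerated_catalan n)%:P).
have XA : dual_fib_at0 = fps_X _ * A by apply: fpsP => n; rewrite fps_XM.
rewrite XA.
have -> : fps_X _ - fps_X _ * ((fps_X _ * A) * (fps_X _ * A)) =
          fps_X _ * (1 - fps_X _ * (fps_X _ * (A * A))) by ring.
congr (_ * _); apply: fpsP => -[|[|n]]; rewrite fpsBE fps_XM fps1E ?subr0 //=.
  by rewrite fps_XM subr0.
rewrite fps_XM sub0r fpsME aerated_catalanS rmorphN rmorph_sum /=.
by congr (- _); apply: eq_bigr => i _; rewrite rmorphM.
Qed.

(** x / (1 + y x) *)
Definition mobius (R : comNzRingType) (y : R) : fps R :=
  Fps (fun n => if n is m.+1 then (- y) ^+ m else 0).

Lemma mobius_denom (R : comNzRingType) (y : R) :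
  mobius y * (1 + fps_const y * fps_X R) = fps_X R.
Proof.
rewrite mulrDr mulr1 mulrCA [mobius y * _]mulrC.
apply: fpsP => n; rewrite fpsDE fps_constM fps_XM.
by case: n => [|[|n]]; rewrite /= ?mulr0 ?addr0 // exprS; ring.
Qed.

(** The second factor is x^k / (1 + y x)^(k+1), the generating function of the
    binomials of fixed lower index k with x scaled by - y.  Multiplying it by
    1 + y x lowers k, by Pascal's rule, whence the induction. *)
Lemma mobius_powS (R : comNzRingType) (y : R) k :
  mobius y ^+ k.+1 =
  fps_X R * Fps (fun n => (- y) ^+ (n - k) *+ 'C(n, k)).
Proof.
elim: k => [|k IHk].
  by apply: fpsP => n; rewrite fps_XM; case: n => // n; rewrite /= subn0 bin0.
set t : fps R := Fps _.
rewrite exprS {}IHk -{2}(mobius_denom y); set t' : fps R := Fps _.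
have -> : fps_X R * t' = (1 + fps_const y * fps_X R) * t; last by rewrite mulrA.
rewrite mulrDl mul1r -mulrA; apply: fpsP => n.
rewrite fpsDE fps_constM !fps_XM; case: n => [|n] /=; first by rewrite mulr0 addr0.
rewrite subSS binS mulrnDr addrAC addrC.
suff -> : (- y) ^+ (n - k) *+ 'C(n, k.+1) +
          y * ((- y) ^+ (n - k.+1) *+ 'C(n, k.+1)) = 0.
  by rewrite addr0.
have [nk|kn] := leqP n k; first by rewrite bin_small ?mulr0n ?mulr0 ?addr0.
by rewrite mulrnAr -mulrnDl -(subnSK kn) exprS mulNr addNr mul0rn.
Qed.

Lemma coef_mobius_powS (R : comNzRingType) (y : R) k n :
  (mobius y ^+ k.+1) n.+1 = (- y) ^+ (n - k) *+ 'C(n, k).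
Proof. by rewrite mobius_powS fps_XM. Qed.

(** Substituting s = x / (1 + y x) into v = x - x v^2 gives u = s - s u^2; after
    multiplication by 1 + y x this is the equation u = x (1 - y u - u^2)
    that characterizes the reversion. *)
Lemma dual_fib_gfE : dual_fib_gf = fps_comp dual_fib_at0 (mobius 'X).
Proof.
set s := mobius 'X; set u := fps_comp _ _.
have s0 : s 0%N = 0 by [].
have uE : u = s - s * (u * u).
  rewrite {1}/u dual_fib_at0E fps_compD fps_compN !fps_compM //.
  by rewrite fps_compX.
have u0 : u 0%N = 0 by rewrite uE fpsBE fpsM0E s0 mul0r subr0.
symmetry; apply: dual_fib_gf_unique => //.
set d := 1 - _ - _.
have ud : d \is a GRing.unit.
  by rewrite fps_unitE !fpsBE fps_constM fpsM0E u0 mulr0 mul0r !subr0 unitr1.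
apply: (canLR (mulrK ud)); rewrite /d.
have uX : u * (1 + fps_const 'X * fps_X _) = fps_X _ * (1 - u * u).
  by rewrite -[in RHS](mobius_denom 'X) -/s [in LHS]uE; ring.
have -> : fps_X _ * (1 - fps_const 'X * u - u ^+ 2) =
  fps_X _ * (1 - u * u) - fps_const 'X * fps_X _ * u by ring.
rewrite -uX; ring.
Qed.

(** The factorial in j! b_j turns the binomials of coef_mobius_powS into the
    quotients n!/k! of an exponential Riordan array. *)
Lemma dual_fibS n :
  dual_fib n.+1 =
  \sum_(k < n.+1)
    (n`!%:R / k`!%:R * ((-1) ^+ k * bessel_coef rat (n - k))) *: 'X^k.
Proof.
rewrite /dual_fib dual_fib_gfE fps_compE big_ord_recl mul0r add0r.
(* The power s^(j+1) contributes to y^(n-j), so j = n - k on the right. *)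
rewrite (reindex_inj rev_ord_inj) /=; apply: eq_bigr => k _.
have le_kn : (k <= n)%N by rewrite -ltnS.
rewrite subSS coef_mobius_powS subKn // bin_sub // add0n.
have nkE : n`!%:R / k`!%:R = (n - k)`!%:R * 'C(n, k)%:R :> rat.
  have nzf : k`!%:R != 0 :> rat by rewrite pnatr_eq0 -lt0n fact_gt0.
  by rewrite -(bin_fact le_kn) !natrM; field.
rewrite [(- 'X) ^+ k]exprNn nkE -mulr_natr /aerated_catalan -mul_polyC.
by rewrite !rmorphM rmorphXn rmorphN1 !rmorph_nat; ring.
Qed.

Lemma exp_riordan_bessel (C : numClosedFieldType) n k :
  exp_riordan (bessel_quot C) (- fps_X C) n k =
  if (k <= n)%N then n`!%:R / k`!%:R * ((-1) ^+ k * bessel_coef C (n - k))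
  else 0.
Proof.
have signE : (-1) ^+ k = fps_const ((-1) ^+ k : C).
  by rewrite rmorphXn rmorphN1.
rewrite /exp_riordan [in LHS]exprNn signE mulrCA fps_constM mulrC.
rewrite [bessel_quot C * _]mulrC coef_fps_XnM bessel_quotE.
by case: leqP; rewrite ?mulr0 ?mul0r // mulrC.
Qed.

Theorem corollary3 (C : numClosedFieldType) :
  is_coef_array
    (fun n : nat => map_poly (ratr : rat -> C) (dual_fib n))
    (exp_riordan (bessel_quot C) (- fps_X C)).
Proof.
split=> [n k nk|n]; first by rewrite exp_riordan_bessel leqNgt nk.
rewrite dual_fibS rmorph_sum; apply: eq_bigr => k _.
rewrite exp_riordan_bessel -ltnS ltn_ord /= map_polyZ map_polyXn.
by rewrite !rmorphM fmorphV !rmorph_nat rmorphXn rmorphN1 /= ratr_bessel_coef.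
Qed.
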